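(* Let $\mathscr{C}$ be a tensor representable category. Then the following statements are equivalent: (i) the right (tensor) dualising functor $R\colon\mathscr{C}^{\mathrm{op}}\to\mathscr{C}$ admits a quasi-inverse; (ii) $\mathscr{C}$ is an $r$-category; (iii) $\mathscr{C}$ is a Grothendieck–Verdier category (i.e. there is an object $d\in\mathscr{C}$ such that $(\mathscr{C},d)$ is a Grothendieck–Verdier category).
   Context: A monoidal category $\mathscr{C}$ (taken strict, with unit $1$) is tensor representable if for every $x\in\mathscr{C}$ there are objects $Rx, Lx\in\mathscr{C}$ such that $x\otimes-$ is left adjoint to $Rx\otimes -$ and $-\otimes x$ is left adjoint to $-\otimes Lx$. Then $\mathscr{C}$ is right closed with $[x,-]_r\cong Rx\otimes-$ right adjoint to $x\otimes-$, and the right dualising functor is $R=[-,1]_r\colon\mathscr{C}^{\mathrm{op}}\to\mathscr{C}$. A (right) Grothendieck–Verdier category is a pair $(\mathscr{C},d)$ of a monoidal category $\mathscr{C}$ and an object $d\in\mathscr{C}$ such that for all $x\in\mathscr{C}$ the functor $\mathscr{C}(x\otimes -,d)$ is representable, $\mathscr{C}(x\otimes-,d)\cong\mathscr{C}(-,D_rx)$, and the induced functor $D_r\colon\mathscr{C}^{\mathrm{op}}\to\mathscr{C}$ is an equivalence of categories. If $d=1$ is the monoidal unit one speaks of an $r$-category. *)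

(* Defs.v *)
From Stdlib Require Import FunctionalExtensionality.

Set Implicit Arguments.
Unset Strict Implicit.
Unset Printing Implicit Defensive.

Declare Scope cat_scope.
Delimit Scope cat_scope with cat.
Local Open Scope cat_scope.

(* Morphisms are compared with Leibniz equality. *)
Record Category := {
  ob :> Type;
  hom : ob -> ob -> Type;
  idm : forall x, hom x x;
  comp : forall x y z, hom y z -> hom x y -> hom x z;
  comp_assoc : forall x y z w (h : hom z w) (g : hom y z) (f : hom x y),
    comp h (comp g f) = comp (comp h g) f;
  comp_idl : forall x y (f : hom x y), comp (idm y) f = f;
  comp_idr : forall x y (f : hom x y), comp f (idm x) = f
}.

Arguments hom {c} x y.
Arguments idm {c} x.
Arguments comp {c x y z} g f.

Notation "g ∘ f" := (comp g f) (at level 40, left associativity) : cat_scope.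

Definition op (C : Category) : Category := {|
  ob := C;
  hom := fun x y => @hom C y x;
  idm := fun x => @idm C x;
  comp := fun x y z g f => @comp C z y x f g;
  comp_assoc := fun x y z w h g f => eq_sym (@comp_assoc C w z y x f g h);
  comp_idl := fun x y f => @comp_idr C y x f;
  comp_idr := fun x y f => @comp_idl C y x f
|}.

Lemma prod_comp_idl (C D : Category) (x y : C * D)
  (f : hom (fst x) (fst y) * hom (snd x) (snd y)) :
  (idm (fst y) ∘ fst f, idm (snd y) ∘ snd f) = f.
Proof. destruct f; cbn; now rewrite !comp_idl. Qed.

Lemma prod_comp_idr (C D : Category) (x y : C * D)
  (f : hom (fst x) (fst y) * hom (snd x) (snd y)) :
  (fst f ∘ idm (fst x), snd f ∘ idm (snd x)) = f.
Proof. destruct f; cbn; now rewrite !comp_idr. Qed.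

Definition prod_cat (C D : Category) : Category := {|
  ob := C * D;
  hom := fun x y => (hom (fst x) (fst y) * hom (snd x) (snd y))%type;
  idm := fun x => (idm (fst x), idm (snd x));
  comp := fun x y z g f => (fst g ∘ fst f, snd g ∘ snd f);
  comp_assoc := fun x y z w h g f =>
    f_equal2 pair (comp_assoc (fst h) (fst g) (fst f))
                  (comp_assoc (snd h) (snd g) (snd f));
  comp_idl := @prod_comp_idl C D;
  comp_idr := @prod_comp_idr C D
|}.

(* The category of sets, where the hom-functors take their values. *)
Definition type_cat : Category := {|
  ob := Type;
  hom := fun A B => A -> B;
  idm := fun A a => a;
  comp := fun A B D g f a => g (f a);
  comp_assoc := fun A B D E h g f => eq_refl;
  comp_idl := fun A B f => eq_refl;
  comp_idr := fun A B f => eq_refl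
|}.

Record Functor (C D : Category) := {
  fob :> C -> D;
  fmap : forall x y, hom x y -> hom (fob x) (fob y);
  fmap_id : forall x, fmap (idm x) = idm (fob x);
  fmap_comp : forall x y z (g : hom y z) (f : hom x y),
    fmap (g ∘ f) = fmap g ∘ fmap f
}.

Arguments fmap {C D} F {x y} f : rename.

Definition id_functor (C : Category) : Functor C C := {|
  fob := fun x => x;
  fmap := fun x y f => f;
  fmap_id := fun x => eq_refl;
  fmap_comp := fun x y z g f => eq_refl
|}.

Section FunctorConstructions.
Variables (C D E : Category) (G : Functor D E) (F : Functor C D).

Lemma comp_functor_id (x : C) : fmap G (fmap F (idm x)) = idm (G (F x)).
Proof. now rewrite !fmap_id. Qed.

Lemma comp_functor_comp (x y z : C) (g : hom y z) (f : hom x y) :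
  fmap G (fmap F (g ∘ f)) = fmap G (fmap F g) ∘ fmap G (fmap F f).
Proof. now rewrite !fmap_comp. Qed.

Definition comp_functor : Functor C E := {|
  fob := fun x => G (F x);
  fmap := fun x y f => fmap G (fmap F f);
  fmap_id := comp_functor_id;
  fmap_comp := comp_functor_comp
|}.

Definition op_functor : Functor (op C) (op D) := {|
  fob := (fun x => F x) : op C -> op D;
  fmap := fun x y f => @fmap C D F y x f;
  fmap_id := fun x => fmap_id F x;
  fmap_comp := fun x y z g f => @fmap_comp C D F z y x f g
|}.

End FunctorConstructions.

Record NatTrans (C D : Category) (F G : Functor C D) := {
  nt :> forall x : C, hom (F x) (G x);
  nt_natural : forall (x y : C) (f : hom x y), nt y ∘ fmap F f = fmap G f ∘ nt x
}.

Record NatIso (C D : Category) (F G : Functor C D) := {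
  ni_to : NatTrans F G;
  ni_from : NatTrans G F;
  ni_to_from : forall x, ni_to x ∘ ni_from x = idm (G x);
  ni_from_to : forall x, ni_from x ∘ ni_to x = idm (F x)
}.

Definition quasi_inverse (C D : Category) (F : Functor C D) (G : Functor D C) : Prop :=
  inhabited (NatIso (comp_functor G F) (id_functor C)) /\
  inhabited (NatIso (comp_functor F G) (id_functor D)).

Definition is_equivalence (C D : Category) (F : Functor C D) : Prop :=
  exists G : Functor D C, quasi_inverse F G.

(* [Adjunction F G] : F is left adjoint to G. *)
Record Adjunction (C D : Category) (F : Functor C D) (G : Functor D C) := {
  adj_unit : NatTrans (id_functor C) (comp_functor G F);
  adj_counit : NatTrans (comp_functor F G) (id_functor D);
  triangle_left : forall x : C, adj_counit (F x) ∘ fmap F (adj_unit x) = idm (F x);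
  triangle_right : forall y : D, fmap G (adj_counit y) ∘ adj_unit (G y) = idm (G y)
}.

Definition transpose (C D : Category) (F : Functor C D) (G : Functor D C)
  (A : Adjunction F G) (x : C) (y : D) (f : hom (F x) y) : hom x (G y) :=
  fmap G f ∘ adj_unit A x.

Definition hom_to (C : Category) (z : C) : Functor (op C) type_cat := {|
  fob := (fun y => @hom C y z) : op C -> type_cat;
  fmap := fun (x y : op C) (f : @hom C y x) (g : @hom C x z) => g ∘ f;
  fmap_id := fun x => functional_extensionality _ _ (fun g => comp_idr g);
  fmap_comp := fun x y w g f =>
    functional_extensionality _ _ (fun k => @comp_assoc C w y x z k f g)
|}.

Record Representation (C : Category) (P : Functor (op C) type_cat) := {
  rep_ob : C;
  rep_iso : NatIso P (hom_to rep_ob)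
}.

Record Iso (C : Category) (x y : C) := {
  iso_to :> hom x y;
  iso_from : hom y x;
  iso_to_from : iso_to ∘ iso_from = idm y;
  iso_from_to : iso_from ∘ iso_to = idm x
}.

Definition tens_ob (C : Category) (T : Functor (prod_cat C C) C) (x y : C) : C :=
  T (x, y).

Definition tens_hom (C : Category) (T : Functor (prod_cat C C) C) (x x' y y' : C)
  (f : hom x x') (g : hom y y') : hom (tens_ob T x y) (tens_ob T x' y') :=
  @fmap (prod_cat C C) C T (x, y) (x', y') (f, g).

(* Not required to be strict: a strict monoidal category is the case in which
   the associator and the unitors are identities. *)
Record MonoidalCategory := {
  mcat :> Category;
  tensor : Functor (prod_cat mcat mcat) mcat;
  munit : mcat;
  associator : forall x y z : mcat,
    Iso (tens_ob tensor (tens_ob tensor x y) z) (tens_ob tensor x (tens_ob tensor y z));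
  lunitor : forall x : mcat, Iso (tens_ob tensor munit x) x;
  runitor : forall x : mcat, Iso (tens_ob tensor x munit) x;
  associator_natural : forall (x x' y y' z z' : mcat)
      (f : hom x x') (g : hom y y') (h : hom z z'),
    associator x' y' z' ∘ tens_hom tensor (tens_hom tensor f g) h =
    tens_hom tensor f (tens_hom tensor g h) ∘ associator x y z;
  lunitor_natural : forall (x x' : mcat) (f : hom x x'),
    lunitor x' ∘ tens_hom tensor (idm munit) f = f ∘ lunitor x;
  runitor_natural : forall (x x' : mcat) (f : hom x x'),
    runitor x' ∘ tens_hom tensor f (idm munit) = f ∘ runitor x;
  pentagon : forall x y z w : mcat,
    associator x y (tens_ob tensor z w) ∘ associator (tens_ob tensor x y) z w =
    tens_hom tensor (idm x) (associator y z w) ∘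
      (associator x (tens_ob tensor y z) w ∘
       tens_hom tensor (associator x y z) (idm w));
  unit_triangle : forall x y : mcat,
    tens_hom tensor (idm x) (lunitor y) ∘ associator x munit y =
    tens_hom tensor (runitor x) (idm y)
}.

Arguments tensor {m}.
Arguments munit m : clear implicits.

Notation "x ⊗ y" := (tens_ob tensor x y)
  (at level 38, left associativity) : cat_scope.
Notation "f ⊗m g" := (tens_hom tensor f g)
  (at level 38, left associativity) : cat_scope.

Section Tensor.
Variable C : MonoidalCategory.

Lemma tens_id (x y : C) : idm x ⊗m idm y = idm (x ⊗ y).
Proof. exact (fmap_id (@tensor C) (x, y)). Qed.

Lemma tens_comp (x x' x'' y y' y'' : C) (f' : hom x' x'') (f : hom x x')
  (g' : hom y' y'') (g : hom y y') :
  (f' ∘ f) ⊗m (g' ∘ g) = (f' ⊗m g') ∘ (f ⊗m g).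
Proof.
exact (@fmap_comp _ _ (@tensor C) (x, y) (x', y') (x'', y'') (f', g') (f, g)).
Qed.

Lemma tens_left_comp (x y y' y'' : C) (g' : hom y' y'') (g : hom y y') :
  idm x ⊗m (g' ∘ g) = (idm x ⊗m g') ∘ (idm x ⊗m g).
Proof. now rewrite <- tens_comp, comp_idl. Qed.

Lemma tens_right_comp (x y y' y'' : C) (g' : hom y' y'') (g : hom y y') :
  (g' ∘ g) ⊗m idm x = (g' ⊗m idm x) ∘ (g ⊗m idm x).
Proof. now rewrite <- tens_comp, comp_idl. Qed.

Lemma tens_exchange (x x' y y' : C) (f : hom x x') (g : hom y y') :
  (f ⊗m idm y') ∘ (idm x ⊗m g) = (idm x' ⊗m g) ∘ (f ⊗m idm y).
Proof. now rewrite <- !tens_comp, !comp_idl, !comp_idr. Qed.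

Definition tens_left (x : C) : Functor C C := {|
  fob := fun y => x ⊗ y;
  fmap := fun y y' g => idm x ⊗m g;
  fmap_id := fun y => tens_id x y;
  fmap_comp := @tens_left_comp x
|}.

Definition tens_right (x : C) : Functor C C := {|
  fob := fun y => y ⊗ x;
  fmap := fun y y' g => g ⊗m idm x;
  fmap_id := fun y => tens_id y x;
  fmap_comp := @tens_right_comp x
|}.

End Tensor.

Record RightClosed (C : MonoidalCategory) := {
  rhom : C -> Functor C C;
  rhom_adj : forall x : C, Adjunction (tens_left x) (rhom x)
}.

Section InternalHom.
Variables (C : MonoidalCategory) (H : RightClosed C) (y : C).

(* [f, y] is the transpose of the evaluation at x' precomposed with f ⊗ id. *)
Definition rhom_contra (x x' : C) (f : hom x x') : hom (rhom H x' y) (rhom H x y) :=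
  @transpose _ _ _ _ (rhom_adj H x) (rhom H x' y) y
    (adj_counit (rhom_adj H x') y ∘ (f ⊗m idm (rhom H x' y))).

Lemma transpose_comp (x u v : C) (g : hom (x ⊗ v) y) (h : hom u v) :
  @transpose _ _ _ _ (rhom_adj H x) u y (g ∘ (idm x ⊗m h)) =
  @transpose _ _ _ _ (rhom_adj H x) v y g ∘ h.
Proof.
unfold transpose.
rewrite (fmap_comp (rhom H x)), <- !comp_assoc.
f_equal. symmetry. exact (nt_natural (adj_unit (rhom_adj H x)) h).
Qed.

Lemma counit_transpose (x u : C) (g : hom (x ⊗ u) y) :
  adj_counit (rhom_adj H x) y ∘
    (idm x ⊗m @transpose _ _ _ _ (rhom_adj H x) u y g) = g.
Proof.
unfold transpose.
rewrite tens_left_comp, comp_assoc.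
transitivity (g ∘ (adj_counit (rhom_adj H x) (x ⊗ u) ∘
                   (idm x ⊗m adj_unit (rhom_adj H x) u))).
- rewrite comp_assoc. f_equal.
  exact (nt_natural (adj_counit (rhom_adj H x)) g).
- etransitivity; [|apply comp_idr]. f_equal.
  exact (triangle_left (rhom_adj H x) u).
Qed.

Lemma rhom_contra_id (x : C) : rhom_contra (idm x) = idm (rhom H x y).
Proof.
unfold rhom_contra. rewrite tens_id, comp_idr.
exact (triangle_right (rhom_adj H x) y).
Qed.

Lemma rhom_contra_comp (x x' x'' : C) (g : hom x' x'') (f : hom x x') :
  rhom_contra (g ∘ f) = rhom_contra f ∘ rhom_contra g.
Proof.
unfold rhom_contra at 2. rewrite <- transpose_comp.
unfold rhom_contra at 1. f_equal.
pose proof (ev := counit_transpose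
  (adj_counit (rhom_adj H x'') y ∘ (g ⊗m idm (rhom H x'' y)))).
fold (rhom_contra g) in ev.
cbn [fob tens_left comp_functor id_functor] in *.
now rewrite tens_right_comp, <- comp_assoc, tens_exchange, !comp_assoc, ev.
Qed.

Definition rhom_functor : Functor (op C) C := {|
  fob := (fun x => rhom H x y) : op C -> C;
  fmap := fun x x' f => @rhom_contra x' x f;
  fmap_id := rhom_contra_id;
  fmap_comp := fun x x' x'' g f => @rhom_contra_comp x'' x' x f g
|}.

End InternalHom.

(* The objects Rx, Lx and the adjunctions are chosen; they are unique up to
   isomorphism. *)
Record TensorRepresentable (C : MonoidalCategory) := {
  Rob : C -> C;
  Lob : C -> C;
  R_adj : forall x : C, Adjunction (tens_left x) (tens_left (Rob x));
  L_adj : forall x : C, Adjunction (tens_right x) (tens_right (Lob x))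
}.

Definition tensor_representable_closed (C : MonoidalCategory)
  (T : TensorRepresentable C) : RightClosed C := {|
  rhom := fun x => tens_left (Rob T x);
  rhom_adj := R_adj T
|}.

(* R = [-, 1]_r.  Its value at x is [Rob T x ⊗ 1], isomorphic to [Rob T x]
   through the right unitor. *)
Definition right_dualising (C : MonoidalCategory) (T : TensorRepresentable C) :
  Functor (op C) C := rhom_functor (tensor_representable_closed T) (munit C).

Definition hom_tens_left (C : MonoidalCategory) (d x : C) :
  Functor (op C) type_cat :=
  comp_functor (hom_to d) (op_functor (tens_left x)).

Section InducedFunctor.
Variables (C : MonoidalCategory) (d : C)
  (rep : forall x : C, Representation (hom_tens_left d x)).

Let phi (x y : C) : hom (x ⊗ y) d -> hom y (rep_ob (rep x)) :=
  ni_to (rep_iso (rep x)) y.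

Let psi (x y : C) : hom y (rep_ob (rep x)) -> hom (x ⊗ y) d :=
  ni_from (rep_iso (rep x)) y.

(* The morphism corresponding, by the Yoneda lemma, to precomposition with
   f ⊗ - : C(x' ⊗ -, d) -> C(x ⊗ -, d). *)
Definition induced_map (x x' : C) (f : hom x x') :
  hom (rep_ob (rep x')) (rep_ob (rep x)) :=
  phi (psi (idm (rep_ob (rep x'))) ∘ (f ⊗m idm (rep_ob (rep x')))).

Lemma phi_comp (x y z : C) (g : hom (x ⊗ y) d) (h : hom z y) :
  phi (g ∘ (idm x ⊗m h)) = phi g ∘ h.
Proof.
exact (equal_f (@nt_natural _ _ _ _ (ni_to (rep_iso (rep x))) y z h) g).
Qed.

Lemma psi_comp (x y z : C) (g : hom y (rep_ob (rep x))) (h : hom z y) :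
  psi (g ∘ h) = psi g ∘ (idm x ⊗m h).
Proof.
exact (equal_f (@nt_natural _ _ _ _ (ni_from (rep_iso (rep x))) y z h) g).
Qed.

Lemma phi_psi (x y : C) (g : hom y (rep_ob (rep x))) : phi (psi g) = g.
Proof. exact (equal_f (ni_to_from (rep_iso (rep x)) y) g). Qed.

Lemma psi_phi (x y : C) (g : hom (x ⊗ y) d) : psi (phi g) = g.
Proof. exact (equal_f (ni_from_to (rep_iso (rep x)) y) g). Qed.

Lemma induced_map_id (x : C) : induced_map (idm x) = idm (rep_ob (rep x)).
Proof. unfold induced_map. rewrite tens_id, comp_idr. apply phi_psi. Qed.

Lemma induced_map_comp (x x' x'' : C) (g : hom x' x'') (f : hom x x') :
  induced_map (g ∘ f) = induced_map f ∘ induced_map g.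
Proof.
unfold induced_map at 2. rewrite <- phi_comp.
rewrite <- comp_assoc, tens_exchange, comp_assoc, <- psi_comp, comp_idl.
unfold induced_map at 2. rewrite psi_phi.
unfold induced_map. now rewrite tens_right_comp, comp_assoc.
Qed.

Definition induced_functor : Functor (op C) C := {|
  fob := (fun x => rep_ob (rep x)) : op C -> C;
  fmap := fun x x' f => @induced_map x' x f;
  fmap_id := induced_map_id;
  fmap_comp := fun x x' x'' g f => @induced_map_comp x'' x' x f g
|}.

End InducedFunctor.

(* The induced functor does not depend, up to natural isomorphism, on the
   choice of the representations. *)
Definition grothendieck_verdier (C : MonoidalCategory) (d : C) : Prop :=
  exists rep : forall x : C, Representation (hom_tens_left d x),
    is_equivalence (induced_functor rep).

Definition r_category (C : MonoidalCategory) : Prop :=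
  grothendieck_verdier (munit C).

(* Main.v *)
Require Import Defs.
From Stdlib Require Import FunctionalExtensionality Setoid Morphisms.

(** Say that a functor [D] dualises [d] when C(x ⊗ y, d) ≅ C(y, D x) naturally
in both variables. Such a [D] is unique up to isomorphism, so (C, d) is a
Grothendieck-Verdier category exactly when some equivalence dualises [d]. The
functor R = [-, 1]_r dualises the unit; hence (i) and (ii) say the same thing,
and (ii) is the case d = 1 of (iii). What remains is that R is an equivalence as
soon as some equivalence [D], with quasi-inverse [E], dualises some object [d].

Put e = E 1, so that D e ≅ 1. Then
  C(x ⊗ y, 1) ≅ C(e ⊗ (x ⊗ y), d) ≅ C(y, D (e ⊗ x)),
so R ≅ D ∘ (e ⊗ -) ([dualises_translate]), and it suffices that [e] be invertible
for ⊗ ([predual_unit_invertible]). This is where tensor representability enters.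
The adjunctions x ⊗ - ⊣ Rx ⊗ - and - ⊗ x ⊣ - ⊗ Lx are only between functors, and
do not make Rx and Lx duals of x in the rigid sense; but the Yoneda lemma still
extracts isomorphisms of objects from them. With r = Re and k = Ld:

 - r ⊗ d ≅ 1, since r ⊗ d and D e both represent C(e ⊗ -, d);
 - e ⊗ k ≅ 1, since C(x, e ⊗ k) ≅ C(x ⊗ d, E 1) ≅ C(x ⊗ d, d) ≅ C(x, E d), where
   E d ≅ 1 and [E] is the left dual: C(x ⊗ y, d) ≅ C(x, E y) ([hom_to_predual]);
 - Rk ⊗ r ≅ 1, since Rk ⊗ (Re ⊗ -) is right adjoint to e ⊗ (k ⊗ -), which is
   isomorphic to the identity.

By the first and third facts [r] is invertible with inverse [d]. Therefore - ⊗ r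
is another right adjoint of - ⊗ d, which gives k ≅ r, and then the second fact
says that [e] is inverse to [r]. *)

Set Implicit Arguments.
Unset Strict Implicit.
Unset Printing Implicit Defensive.
Local Open Scope cat_scope.

(** * Isomorphism as an equivalence relation *)

(** Only the existence of isomorphisms matters below, so they are truncated to
propositions; this makes them available to setoid rewriting. *)
Definition isomorphic (C : Category) (x y : C) : Prop := inhabited (Iso x y).

Definition nat_isomorphic (C D : Category) (F G : Functor C D) : Prop :=
  inhabited (NatIso F G).

Notation "x ≅ y" := (isomorphic x y) (at level 70, no associativity) : cat_scope.
Notation "F ≈ G" := (nat_isomorphic F G) (at level 70, no associativity) : cat_scope.

#[local] Instance isomorphic_equivalence (C : Category) :
  Equivalence (@isomorphic C).
Proof.
split.
- intros x. constructor. exists (idm x) (idm x); apply comp_idl.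
- intros x y [[f g fg gf]]. constructor. now exists g f.
- intros x y z [[f f' ff' f'f]] [[g g' gg' g'g]].
  constructor. exists (g ∘ f) (f' ∘ g').
  + now rewrite comp_assoc, <- (comp_assoc g), ff', comp_idr.
  + now rewrite comp_assoc, <- (comp_assoc f'), g'g, comp_idr.
Qed.

(** Naturality of the inverse is automatic. *)
Lemma nat_iso_of_isos (C D : Category) (F G : Functor C D)
  (i : forall x, Iso (F x) (G x)) :
  (forall (x y : C) (f : hom x y), i y ∘ fmap F f = fmap G f ∘ i x) -> F ≈ G.
Proof.
intros nat.
assert (nat' : forall (x y : C) (f : hom x y),
  iso_from (i y) ∘ fmap G f = fmap F f ∘ iso_from (i x)).
{ intros x y f.
  rewrite <- (comp_idr (fmap G f)), <- (iso_to_from (i x)), (comp_assoc (fmap G f)).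
  now rewrite <- nat, !comp_assoc, iso_from_to, comp_idl. }
constructor.
exists (@Build_NatTrans _ _ F G (fun x => iso_to (i x)) nat)
  (@Build_NatTrans _ _ G F (fun x => iso_from (i x)) nat').
- intros x. apply iso_to_from.
- intros x. apply iso_from_to.
Qed.

Definition iso_component (C D : Category) (F G : Functor C D) (N : NatIso F G)
  (x : C) : Iso (F x) (G x) := {|
  iso_to := ni_to N x;
  iso_from := ni_from N x;
  iso_to_from := ni_to_from N x;
  iso_from_to := ni_from_to N x
|}.

#[local] Instance nat_isomorphic_equivalence (C D : Category) :
  Equivalence (@nat_isomorphic C D).
Proof.
split.
- intros F.
  apply (nat_iso_of_isos (i := fun x => {|
    iso_to_from := comp_idl (idm (F x)); iso_from_to := comp_idl (idm (F x)) |})).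
  intros x y f. cbn. now rewrite comp_idl, comp_idr.
- intros F G [[a b ab ba]]. constructor. now exists b a.
- intros F G H [M] [N].
  assert (i : forall x, {i : Iso (F x) (H x) | iso_to i = ni_to N x ∘ ni_to M x}).
  { intros x. unshelve eexists (Build_Iso (iso_to := ni_to N x ∘ ni_to M x)
      (iso_from := ni_from M x ∘ ni_from N x) _ _); [..|reflexivity].
    - now rewrite comp_assoc, <- (comp_assoc (ni_to N x)), ni_to_from, comp_idr,
        ni_to_from.
    - now rewrite comp_assoc, <- (comp_assoc (ni_from M x)), ni_from_to, comp_idr,
        ni_from_to. }
  apply (nat_iso_of_isos (i := fun x => proj1_sig (i x))).
  intros x y f. rewrite !(proj2_sig (i _)).
  now rewrite <- comp_assoc, nt_natural, comp_assoc, nt_natural, comp_assoc.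
Qed.

Lemma nat_isomorphic_ob (C D : Category) (F G : Functor C D) (x : C) :
  F ≈ G -> F x ≅ G x.
Proof. intros [N]. constructor. exact (iso_component N x). Qed.

Definition fmap_iso (C D : Category) (F : Functor C D) (x y : C) (i : Iso x y) :
  Iso (F x) (F y).
Proof.
exists (fmap F i) (fmap F (iso_from i));
  rewrite <- fmap_comp, ?iso_to_from, ?iso_from_to; apply fmap_id.
Defined.

#[local] Instance fob_proper (C D : Category) (F : Functor C D) :
  Proper (@isomorphic C ==> @isomorphic D) (fob F).
Proof. intros x y [i]. constructor. exact (fmap_iso F i). Qed.

Lemma isomorphic_op (C : Category) (x y : C) :
  @isomorphic (op C) x y -> x ≅ y.
Proof. intros [[f g fg gf]]. constructor. now exists g f. Qed.

#[local] Instance comp_functor_proper (C D E : Category) :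
  Proper (@nat_isomorphic D E ==> @nat_isomorphic C D ==> @nat_isomorphic C E)
    (@comp_functor C D E).
Proof.
intros G G' [N] F F' [M].
transitivity (comp_functor G' F).
- apply (@nat_iso_of_isos _ _ (comp_functor G F) (comp_functor G' F)
    (fun x => iso_component N (F x))).
  intros x y f. exact (nt_natural (ni_to N) (fmap F f)).
- apply (@nat_iso_of_isos _ _ (comp_functor G' F) (comp_functor G' F')
    (fun x => fmap_iso G' (iso_component M x))).
  intros x y f. cbn. rewrite <- !fmap_comp. f_equal. apply nt_natural.
Qed.

(** Composites that differ only by their bracketing or by identity functors have
the same values; this absorbs the difference of their functoriality proofs. *)
Lemma nat_isomorphic_same_values (C D : Category) (o : C -> D)
  (m m' : forall x y, hom x y -> hom (o x) (o y)) idm_m idm_m' comp_m comp_m' :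
  (forall x y (f : hom x y), m x y f = m' x y f) ->
  @Build_Functor C D o m idm_m comp_m ≈ @Build_Functor C D o m' idm_m' comp_m'.
Proof.
intros mm.
apply (@nat_iso_of_isos C D (Build_Functor idm_m comp_m)
  (Build_Functor idm_m' comp_m') (fun x => {|
  iso_to_from := comp_idl (idm (o x)); iso_from_to := comp_idl (idm (o x)) |})).
intros x y f. cbn. now rewrite comp_idl, comp_idr.
Qed.

Lemma comp_functor_assoc (A B C D : Category) (H : Functor C D) (G : Functor B C)
  (F : Functor A B) :
  comp_functor H (comp_functor G F) ≈ comp_functor (comp_functor H G) F.
Proof. now apply nat_isomorphic_same_values. Qed.

Lemma comp_functor_idl (C D : Category) (F : Functor C D) :
  comp_functor (id_functor D) F ≈ F.
Proof. destruct F. now apply nat_isomorphic_same_values. Qed.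

Lemma comp_functor_op_id (C D : Category) (F : Functor (op C) D) :
  comp_functor F (op_functor (id_functor C)) ≈ F.
Proof. destruct F. now apply nat_isomorphic_same_values. Qed.

Lemma comp_functor_op_comp (A B C D : Category) (H : Functor (op C) D)
  (G : Functor B C) (F : Functor A B) :
  comp_functor (comp_functor H (op_functor G)) (op_functor F) ≈
  comp_functor H (op_functor (comp_functor G F)).
Proof. now apply nat_isomorphic_same_values. Qed.

Lemma op_functor_comp (C D E : Category) (G : Functor D E) (F : Functor C D) :
  comp_functor (op_functor G) (op_functor F) ≈ op_functor (comp_functor G F).
Proof. now apply nat_isomorphic_same_values. Qed.

Lemma op_functor_id (C : Category) :
  op_functor (id_functor C) ≈ id_functor (op C).
Proof. now apply nat_isomorphic_same_values. Qed.

#[local] Instance op_functor_proper (C D : Category) :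
  Proper (@nat_isomorphic C D ==> @nat_isomorphic (op C) (op D))
    (@op_functor C D).
Proof.
intros F G [N]. constructor.
exists (@Build_NatTrans _ _ (op_functor F) (op_functor G) (fun x => ni_from N x)
    (fun x y f => eq_sym (nt_natural (ni_from N) f)))
  (@Build_NatTrans _ _ (op_functor G) (op_functor F) (fun x => ni_to N x)
    (fun x y f => eq_sym (nt_natural (ni_to N) f))).
- intros x. apply (ni_to_from N).
- intros x. apply (ni_from_to N).
Qed.

(** * Equivalences *)

Lemma is_equivalence_iso (C D : Category) (F G : Functor C D) :
  F ≈ G -> is_equivalence F -> is_equivalence G.
Proof.
intros FG [K [KF FK]]. exists K. split.
- change (comp_functor K G ≈ id_functor C). rewrite <- FG. exact KF.
- change (comp_functor G K ≈ id_functor D). rewrite <- FG. exact FK.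
Qed.

Lemma comp_cancel_inner (A B C D : Category) (F : Functor A B) (G : Functor B C)
  (G' : Functor C B) (F' : Functor B D) :
  comp_functor G' G ≈ id_functor B ->
  comp_functor (comp_functor F' G') (comp_functor G F) ≈ comp_functor F' F.
Proof.
intros GG.
now rewrite <- comp_functor_assoc, (comp_functor_assoc G'), GG, comp_functor_idl.
Qed.

Lemma is_equivalence_comp (C D E : Category) (F : Functor C D) (G : Functor D E) :
  is_equivalence F -> is_equivalence G -> is_equivalence (comp_functor G F).
Proof.
intros [F' [F'F FF']] [G' [G'G GG']]. exists (comp_functor F' G'). split.
- change (comp_functor (comp_functor F' G') (comp_functor G F) ≈ id_functor C).
  now rewrite comp_cancel_inner.
- change (comp_functor (comp_functor G F) (comp_functor F' G') ≈ id_functor E).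
  now rewrite comp_cancel_inner.
Qed.

Lemma is_equivalence_op (C D : Category) (F : Functor C D) :
  is_equivalence F -> is_equivalence (op_functor F).
Proof.
intros [G [GF FG]]. exists (op_functor G). split.
- change (comp_functor (op_functor G) (op_functor F) ≈ id_functor (op C)).
  change (comp_functor G F ≈ id_functor C) in GF.
  now rewrite op_functor_comp, GF, op_functor_id.
- change (comp_functor (op_functor F) (op_functor G) ≈ id_functor (op D)).
  change (comp_functor F G ≈ id_functor D) in FG.
  now rewrite op_functor_comp, FG, op_functor_id.
Qed.

(** * Representable functors *)

(** A representation needs naturality in one direction only, checked on
elements. *)
Lemma hom_to_iso (C : Category) (P : Functor (op C) type_cat) (b : C)
  (to : forall x : C, P x -> hom x b) (from : forall x : C, hom x b -> P x) :
  (forall x g, to x (from x g) = g) -> (forall x g, from x (to x g) = g) ->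
  (forall (x y : C) (g : P x) (f : hom y x),
     to y (@fmap (op C) type_cat P x y f g) = to x g ∘ f) ->
  P ≈ hom_to b.
Proof.
intros tf ft nat.
apply (@nat_iso_of_isos _ _ P (hom_to b) (fun x =>
  @Build_Iso type_cat (P x) (hom_to b x) (to x) (from x)
   (functional_extensionality _ _ (tf x)) (functional_extensionality _ _ (ft x)))).
intros x y f. apply functional_extensionality; intros g. apply nat.
Qed.

Lemma yoneda (C : Category) (a b : C) : hom_to a ≈ hom_to b -> a ≅ b.
Proof.
intros [N].
pose (f := ni_to N a (idm a) : hom a b).
pose (g := ni_from N b (idm b) : hom b a).
assert (to_comp : forall x (h : hom x a), ni_to N x h = f ∘ h).
{ intros x h. rewrite <- (comp_idl h) at 1.
  exact (equal_f (@nt_natural _ _ _ _ (ni_to N) a x h) (idm a)). }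
assert (from_comp : forall x (h : hom x b), ni_from N x h = g ∘ h).
{ intros x h. rewrite <- (comp_idl h) at 1.
  exact (equal_f (@nt_natural _ _ _ _ (ni_from N) b x h) (idm b)). }
constructor. exists f g.
- rewrite <- to_comp. exact (equal_f (ni_to_from N b) (idm b)).
- rewrite <- from_comp. exact (equal_f (ni_from_to N a) (idm a)).
Qed.

(** A right adjoint enters the argument only through the object that it assigns
to [y], as the representing object of [hom (F -) y]; composites of such facts
replace the calculus of adjunctions. *)
Lemma hom_to_adjoint (C D : Category) (F : Functor C D) (G : Functor D C) (y : D) :
  Adjunction F G -> comp_functor (hom_to y) (op_functor F) ≈ hom_to (G y).
Proof.
intros A.
apply (@hom_to_iso C (comp_functor (hom_to y) (op_functor F)) (G y)
  (fun x g => transpose A g) (fun x h => adj_counit A y ∘ fmap F h)).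
- intros x h. unfold transpose. rewrite fmap_comp, <- comp_assoc.
  transitivity (fmap G (adj_counit A y) ∘ (adj_unit A (G y) ∘ h)).
  + f_equal. symmetry. exact (nt_natural (adj_unit A) h).
  + rewrite comp_assoc.
    transitivity (idm (G y) ∘ h); [|apply comp_idl].
    f_equal. exact (triangle_right A y).
- intros x g. unfold transpose. rewrite fmap_comp, comp_assoc.
  transitivity (g ∘ adj_counit A (F x) ∘ fmap F (adj_unit A x)).
  + f_equal. exact (nt_natural (adj_counit A) g).
  + rewrite <- comp_assoc. etransitivity; [|apply comp_idr].
    f_equal. exact (triangle_left A x).
- intros x y' g f. unfold transpose. cbn. rewrite fmap_comp, <- !comp_assoc.
  f_equal. symmetry. exact (nt_natural (adj_unit A) f).
Qed.

(** The inverse is returned as a single function of all arguments, so that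
natural families can be built from it without choice. It is conjugation of
[fmap G] by the isomorphism G F ≅ id. *)
Lemma fmap_bijective (C D : Category) (F : Functor C D) :
  is_equivalence F ->
  exists inv : forall x y : C, hom (F x) (F y) -> hom x y,
    (forall x y (f : hom x y), inv x y (fmap F f) = f) /\
    (forall x y (g : hom (F x) (F y)), fmap F (inv x y g) = g).
Proof.
intros [G [[M] [N]]].
(* [G] is faithful because F G ≅ id, and [inv] is a section of the action of [F]
   as soon as it is one after applying [G]. *)
assert (faithful : forall x y (g g' : hom (F x) (F y)), fmap G g = fmap G g' -> g = g').
{ intros x y g g' e.
  enough (g ∘ ni_to N (F x) = g' ∘ ni_to N (F x)) as e'.
  { rewrite <- (comp_idr g), <- (comp_idr g').
    change (idm (F x)) with (idm (id_functor D (F x))).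
    rewrite <- (ni_to_from N (F x)).
    change (g ∘ (ni_to N (F x) ∘ ni_from N (F x)) =
      g' ∘ (ni_to N (F x) ∘ ni_from N (F x))).
    rewrite (comp_assoc g), (comp_assoc g').
    exact (f_equal (fun h => h ∘ ni_from N (F x)) e'). }
  transitivity (ni_to N (F y) ∘ fmap F (fmap G g)).
  - symmetry. exact (nt_natural (ni_to N) g).
  - rewrite e. exact (nt_natural (ni_to N) g'). }
pose (inv := fun x y (g : hom (F x) (F y)) =>
  (ni_to M y ∘ (fmap G g ∘ ni_from M x)) : hom x y).
assert (left_inv : forall x y (f : hom x y), inv x y (fmap F f) = f).
{ intros x y f. unfold inv.
  transitivity (ni_to M y ∘ (ni_from M y ∘ f)).
  - f_equal. symmetry. exact (nt_natural (ni_from M) f).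
  - rewrite comp_assoc. transitivity (idm y ∘ f); [|apply comp_idl].
    f_equal. exact (ni_to_from M y). }
exists inv. split; [exact left_inv|].
intros x y g. apply faithful.
assert (G_inv : forall h : hom (F x) (F y),
  fmap G h = ni_from M y ∘ (inv x y h ∘ ni_to M x)).
{ intros h. unfold inv. rewrite !comp_assoc.
  transitivity (idm _ ∘ fmap G h ∘ idm _); [now rewrite comp_idl, comp_idr|].
  rewrite <- !comp_assoc. change (id_functor C x) with x.
  rewrite (comp_assoc (ni_from M y)).
  f_equal; [symmetry; exact (ni_from_to M y)|].
  f_equal. symmetry. exact (ni_from_to M x). }
now rewrite (G_inv (fmap F (inv x y g))), left_inv, (G_inv g).
Qed.

(** Full faithfulness of an equivalence, in the form that composes with
[hom_to_adjoint] and [yoneda]. *)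
Lemma hom_to_equivalence (C D : Category) (F : Functor C D) (a : C) :
  is_equivalence F -> comp_functor (hom_to (F a)) (op_functor F) ≈ hom_to a.
Proof.
intros eF.
destruct (fmap_bijective eF) as [inv [inv_fmap fmap_inv]].
symmetry.
apply nat_iso_of_isos with (F := hom_to a)
  (G := comp_functor (hom_to (F a)) (op_functor F)) (i := fun x =>
  @Build_Iso type_cat (hom_to a x) (hom (F x) (F a)) (fun f => fmap F f)
   (inv x a)
   (functional_extensionality _ _ (fmap_inv x a))
   (functional_extensionality _ _ (inv_fmap x a))).
intros x y f. apply functional_extensionality; intros g.
exact (@fmap_comp _ _ F y x a g f).
Qed.

(** * Tensoring with an object *)

Section Monoidal.
Variable C : MonoidalCategory.
Implicit Types a b c x y d : C.

#[local] Instance tens_ob_proper :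
  Proper (@isomorphic C ==> @isomorphic C ==> @isomorphic C) (tens_ob tensor).
Proof.
intros a a' [[f f' ff' f'f]] b b' [[g g' gg' g'g]].
constructor. exists (f ⊗m g) (f' ⊗m g'); rewrite <- tens_comp.
- now rewrite ff', gg', tens_id.
- now rewrite f'f, g'g, tens_id.
Qed.

Lemma tens_assoc a b c : a ⊗ b ⊗ c ≅ a ⊗ (b ⊗ c).
Proof. constructor. apply associator. Qed.

Lemma tens_unit_left a : munit C ⊗ a ≅ a.
Proof. constructor. apply lunitor. Qed.

Lemma tens_unit_right a : a ⊗ munit C ≅ a.
Proof. constructor. apply runitor. Qed.

(** The usual monoid argument a ≅ a ⊗ (b ⊗ c) ≅ (a ⊗ b) ⊗ c ≅ c. *)
Lemma left_right_inverse a b c :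
  a ⊗ b ≅ munit C -> b ⊗ c ≅ munit C -> a ≅ c.
Proof.
intros ab bc.
now rewrite <- (tens_unit_right a), <- bc, <- tens_assoc, ab, tens_unit_left.
Qed.

#[local] Instance tens_left_proper :
  Proper (@isomorphic C ==> @nat_isomorphic C C) (@tens_left C).
Proof.
intros a b [[f g fg gf]].
unshelve eapply (@nat_iso_of_isos C C (tens_left a) (tens_left b)).
- intros x. exists (f ⊗m idm x) (g ⊗m idm x).
  + now rewrite <- tens_comp, fg, comp_idl, tens_id.
  + now rewrite <- tens_comp, gf, comp_idl, tens_id.
- intros x y h. apply tens_exchange.
Qed.

#[local] Instance tens_right_proper :
  Proper (@isomorphic C ==> @nat_isomorphic C C) (@tens_right C).
Proof.
intros a b [[f g fg gf]].
unshelve eapply (@nat_iso_of_isos C C (tens_right a) (tens_right b)).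
- intros x. exists (idm x ⊗m f) (idm x ⊗m g).
  + now rewrite <- tens_comp, fg, comp_idl, tens_id.
  + now rewrite <- tens_comp, gf, comp_idl, tens_id.
- intros x y h. symmetry. apply tens_exchange.
Qed.

Lemma tens_left_unit : tens_left (munit C) ≈ id_functor C.
Proof.
apply (@nat_iso_of_isos C C (tens_left (munit C)) (id_functor C) (@lunitor C)).
intros x y f. apply lunitor_natural.
Qed.

Lemma tens_right_unit : tens_right (munit C) ≈ id_functor C.
Proof.
apply (@nat_iso_of_isos C C (tens_right (munit C)) (id_functor C) (@runitor C)).
intros x y f. apply runitor_natural.
Qed.

Lemma tens_left_tens a b :
  tens_left (a ⊗ b) ≈ comp_functor (tens_left a) (tens_left b).
Proof.
apply (@nat_iso_of_isos C C (tens_left (a ⊗ b))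
  (comp_functor (tens_left a) (tens_left b)) (associator a b)).
intros x y f. cbn. rewrite <- tens_id. apply associator_natural.
Qed.

Lemma tens_right_tens a b :
  tens_right (a ⊗ b) ≈ comp_functor (tens_right b) (tens_right a).
Proof.
symmetry.
apply (@nat_iso_of_isos C C (comp_functor (tens_right b) (tens_right a))
  (tens_right (a ⊗ b)) (fun x => associator x a b)).
intros x y f. cbn. rewrite <- tens_id. apply associator_natural.
Qed.

Lemma tens_left_equivalence a b :
  a ⊗ b ≅ munit C -> b ⊗ a ≅ munit C -> is_equivalence (tens_left a).
Proof.
intros ab ba. exists (tens_left b). split.
- change (comp_functor (tens_left b) (tens_left a) ≈ id_functor C).
  now rewrite <- tens_left_tens, ba, tens_left_unit.
- change (comp_functor (tens_left a) (tens_left b) ≈ id_functor C).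
  now rewrite <- tens_left_tens, ab, tens_left_unit.
Qed.

Lemma tens_right_equivalence a b :
  a ⊗ b ≅ munit C -> b ⊗ a ≅ munit C -> is_equivalence (tens_right a).
Proof.
intros ab ba. exists (tens_right b). split.
- change (comp_functor (tens_right b) (tens_right a) ≈ id_functor C).
  now rewrite <- tens_right_tens, ab, tens_right_unit.
- change (comp_functor (tens_right a) (tens_right b) ≈ id_functor C).
  now rewrite <- tens_right_tens, ba, tens_right_unit.
Qed.

(** * Dualising functors *)

(** The functor [D] is part of the data and naturality is asked in both
variables, so that the functors induced by representations and by internal homs
can be compared. *)
Record Dualises (d : C) (D : Functor (op C) C) := {
  curry : forall x y : C, hom (x ⊗ y) d -> hom y (D x);
  uncurry : forall x y : C, hom y (D x) -> hom (x ⊗ y) d;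
  curry_uncurry : forall x y (g : hom y (D x)), curry (uncurry g) = g;
  uncurry_curry : forall x y (g : hom (x ⊗ y) d), uncurry (curry g) = g;
  curry_natural_right : forall x y z (g : hom (x ⊗ y) d) (h : hom z y),
    curry (g ∘ (idm x ⊗m h)) = curry g ∘ h;
  curry_natural_left : forall x x' y (g : hom (x ⊗ y) d) (f : hom x' x),
    curry (g ∘ (f ⊗m idm y)) = @fmap (op C) C D x x' f ∘ curry g
}.

Lemma uncurry_natural_right d D (K : Dualises d D) x y z (g : hom y (D x))
  (h : hom z y) :
  uncurry K (g ∘ h) = uncurry K g ∘ (idm x ⊗m h).
Proof.
now rewrite <- (uncurry_curry K (_ ∘ (idm x ⊗m h))), curry_natural_right,
  curry_uncurry.
Qed.

Lemma hom_to_dual d D (K : Dualises d D) x :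
  hom_tens_left d x ≈ hom_to (D x).
Proof.
apply (@hom_to_iso C (hom_tens_left d x) (D x) (curry K (x := x))
  (uncurry K (x := x))).
- apply curry_uncurry.
- apply uncurry_curry.
- intros y z g h. apply curry_natural_right.
Qed.

(** The comparison D x -> D' x corresponds, by the Yoneda lemma, to the evaluation
x ⊗ D x -> d. *)
Lemma dualises_unique d D D' : Dualises d D -> Dualises d D' -> D ≈ D'.
Proof.
intros K K'.
assert (inv : forall A B (M : Dualises d A) (N : Dualises d B) (x : C),
  curry N (uncurry M (idm (A x))) ∘ curry M (uncurry N (idm (B x))) = idm (B x)).
{ intros A B M N x.
  now rewrite <- curry_natural_right, <- uncurry_natural_right, comp_idl,
    uncurry_curry, curry_uncurry. }
apply (@nat_iso_of_isos (op C) C D D' (fun x => {|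
  iso_to_from := inv D D' K K' x; iso_from_to := inv D' D K' K x |})).
intros x y f. cbn.
rewrite <- curry_natural_right, <- curry_natural_left.
rewrite <- uncurry_natural_right, comp_idl. f_equal.
rewrite <- (uncurry_curry K (_ ∘ (_ ⊗m _))). f_equal.
now rewrite curry_natural_left, curry_uncurry, comp_idr.
Qed.

Lemma induced_functor_dualises d
  (rep : forall x : C, Representation (hom_tens_left d x)) :
  Dualises d (induced_functor rep).
Proof.
apply (@Build_Dualises d (induced_functor rep)
  (fun x y g => ni_to (rep_iso (rep x)) y g)
  (fun x y g => ni_from (rep_iso (rep x)) y g)).
- intros x y g. apply phi_psi.
- intros x y g. apply psi_phi.
- intros x y z g h. apply phi_comp.
- intros x x' y g f. cbn. unfold induced_map.
  rewrite <- phi_comp. f_equal.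
  rewrite <- comp_assoc, tens_exchange, comp_assoc, <- psi_comp, comp_idl.
  now rewrite psi_phi.
Qed.

Lemma rhom_functor_dualises (H : RightClosed C) d :
  Dualises d (rhom_functor H d).
Proof.
apply (@Build_Dualises d (rhom_functor H d)
  (fun x y g => transpose (rhom_adj H x) g)
  (fun x y g => adj_counit (rhom_adj H x) d ∘ (idm x ⊗m g))).
- intros x y g.
  transitivity (transpose (rhom_adj H x) (adj_counit (rhom_adj H x) d) ∘ g);
    [exact (@transpose_comp C H d x _ _ _ g)|].
  transitivity (idm (rhom H x d) ∘ g); [|apply comp_idl]. f_equal.
  exact (triangle_right (rhom_adj H x) d).
- intros x y g. apply counit_transpose.
- intros x y z g h. apply transpose_comp.
- intros x x' y g f. cbn. unfold rhom_contra.
  etransitivity; [|exact (@transpose_comp C H d x' _ _ _ _)]. f_equal.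
  cbn [fob comp_functor id_functor tens_left].
  rewrite <- comp_assoc, tens_exchange, comp_assoc. f_equal.
  symmetry. apply counit_transpose.
Qed.

(** Eliminates the choice of representations: by uniqueness, the functor induced
by any choice is an equivalence once some functor dualising [d] is. *)
Lemma grothendieck_verdier_dualises d :
  grothendieck_verdier d <->
  exists D, inhabited (Dualises d D) /\ is_equivalence D.
Proof.
split.
- intros [rep eD]. exists (induced_functor rep). split; [|exact eD].
  constructor. apply induced_functor_dualises.
- intros [D [[K] eD]].
  unshelve eexists.
  { intros x. exists (D x).
    unshelve econstructor.
    - exists (fun y => @curry d D K x y).
      intros y z f. apply functional_extensionality; intros g.
      apply curry_natural_right.
    - exists (fun y => @uncurry d D K x y).
      intros y z f. apply functional_extensionality; intros g.
      apply uncurry_natural_right.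
    - intros y. apply functional_extensionality; intros g. apply curry_uncurry.
    - intros y. apply functional_extensionality; intros g. apply uncurry_curry. }
  eapply is_equivalence_iso; [|exact eD].
  exact (dualises_unique K (induced_functor_dualises _)).
Qed.

Lemma dualises_iso d d' D : d ≅ d' -> Dualises d D -> inhabited (Dualises d' D).
Proof.
intros [[f g fg gf]] K. constructor.
apply (@Build_Dualises d' D (fun x y h => curry K (g ∘ h))
  (fun x y h => f ∘ uncurry K h)).
- intros x y h. now rewrite comp_assoc, gf, comp_idl, curry_uncurry.
- intros x y h. now rewrite uncurry_curry, comp_assoc, fg, comp_idl.
- intros x y z h k. now rewrite comp_assoc, curry_natural_right.
- intros x x' y h k. now rewrite comp_assoc, curry_natural_left.
Qed.

(** Two applications of the duality of [d] around the associator: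
C(x ⊗ y, D e) ≅ C(e ⊗ (x ⊗ y), d) ≅ C((e ⊗ x) ⊗ y, d) ≅ C(y, D (e ⊗ x)). *)
Lemma dualises_translate d D e :
  Dualises d D ->
  Dualises (D e) (comp_functor D (op_functor (tens_left e))).
Proof.
intros K.
apply (@Build_Dualises (D e) (comp_functor D (op_functor (tens_left e)))
  (fun x y g => curry K (uncurry K g ∘ associator e x y))
  (fun x y g => curry K (uncurry K g ∘ iso_from (associator e x y)))).
- intros x y g.
  now rewrite uncurry_curry, <- comp_assoc, iso_from_to, comp_idr, curry_uncurry.
- intros x y g.
  now rewrite uncurry_curry, <- comp_assoc, iso_to_from, comp_idr, curry_uncurry.
- intros x y z g h.
  rewrite uncurry_natural_right, <- comp_assoc, <- associator_natural, tens_id.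
  now rewrite comp_assoc, curry_natural_right.
- intros x x' y g f.
  rewrite uncurry_natural_right, <- comp_assoc, <- associator_natural.
  now rewrite comp_assoc, curry_natural_left.
Qed.

(** * Invertibility of the dualising object *)

Section QuasiInverse.
Variables (d : C) (D : Functor (op C) C) (E : Functor C (op C)).
Hypotheses (K : Dualises d D) (DE : quasi_inverse D E).

Let quasi_inverse_equivalence : is_equivalence E.
Proof. exists D. destruct DE. now split. Qed.

(** Both objects represent C(1 ⊗ -, d). *)
Lemma dual_unit : D (munit C) ≅ d.
Proof.
apply yoneda.
rewrite <- (hom_to_dual K (munit C)). unfold hom_tens_left.
now rewrite tens_left_unit, comp_functor_op_id.
Qed.

Lemma predual_dual x : (E (D x) : C) ≅ x.
Proof.
apply isomorphic_op. destruct DE as [ED _].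
exact (@nat_isomorphic_ob (op C) (op C) _ _ x ED).
Qed.

Lemma dual_predual x : D (E x) ≅ x.
Proof. destruct DE as [_ DE']. exact (nat_isomorphic_ob x DE'). Qed.

(** [E] inverts [dual_unit]: E d ≅ E (D 1) ≅ 1. *)
Lemma predual_dualising : (E d : C) ≅ munit C.
Proof.
rewrite <- (predual_dual (munit C)).
apply isomorphic_op. now rewrite dual_unit.
Qed.

(** A quasi-inverse of a right dual is a left dual: applying [E] to a morphism
y -> D x gives E (D x) -> E y, that is, x -> E y. *)
Lemma hom_to_predual y :
  comp_functor (hom_to d) (op_functor (tens_right y)) ≈ hom_to (E y : C).
Proof.
destruct DE as [[M] _].
destruct (fmap_bijective quasi_inverse_equivalence) as [inv [inv_E E_inv]].
pose (u := fun x : C => ni_to M x : @hom C x (E (D x))).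
pose (v := fun x : C => ni_from M x : @hom C (E (D x)) x).
assert (vu : forall x : C, v x ∘ u x = idm x) by exact (ni_to_from M).
assert (uv : forall x : C, u x ∘ v x = idm (E (D x) : C)) by exact (ni_from_to M).
apply (@hom_to_iso C (comp_functor (hom_to d) (op_functor (tens_right y))) (E y)
  (fun x g => (@fmap C (op C) E _ _ (curry K g) : @hom C (E (D x)) (E y)) ∘ u x)
  (fun x h => uncurry K (inv y (D x) (h ∘ v x : @hom C (E (D x)) (E y))))).
- intros x h. rewrite curry_uncurry, E_inv, <- comp_assoc, vu. apply comp_idr.
- intros x g. rewrite <- comp_assoc, uv, comp_idr, inv_E. apply uncurry_curry.
- intros x x' g f. cbn. rewrite curry_natural_left.
  rewrite (@fmap_comp _ _ E). cbn. rewrite <- !comp_assoc. f_equal.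
  exact (nt_natural (ni_to M) f).
Qed.

Variable T : TensorRepresentable C.

(** From r ⊗ d ≅ 1, e ⊗ k ≅ 1 and Rk ⊗ r ≅ 1 alone, [r] has inverse [d], but [e]
has only a right inverse [k]. The remaining link k ≅ r comes from comparing two
right adjoints of - ⊗ d. *)
Lemma predual_unit_invertible :
  exists r : C, (E (munit C) : C) ⊗ r ≅ munit C /\ r ⊗ E (munit C) ≅ munit C.
Proof.
set (e := E (munit C) : C). set (r := Rob T e). set (k := Lob T d).
assert (rd : r ⊗ d ≅ munit C).
{ transitivity (D e); [apply yoneda | apply dual_predual].
  rewrite <- (hom_to_dual K e). symmetry. exact (hom_to_adjoint d (R_adj T e)). }
(* Both sides represent x ↦ C(x ⊗ d, d), up to E d ≅ 1. *)
assert (ek : e ⊗ k ≅ munit C).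
{ rewrite <- predual_dualising. apply yoneda.
  rewrite <- hom_to_predual.
  transitivity (comp_functor (hom_to e) (op_functor (tens_right d))).
  { symmetry. exact (hom_to_adjoint e (L_adj T d)). }
  unfold e. rewrite <- hom_to_predual.
  now rewrite tens_right_unit, comp_functor_op_id. }
(* Both sides represent C(e ⊗ (k ⊗ -), 1). *)
assert (Rk_r : Rob T k ⊗ r ≅ munit C).
{ rewrite <- (tens_unit_right r), <- tens_assoc, (tens_assoc (Rob T k)).
  apply yoneda.
  transitivity (comp_functor (hom_to (r ⊗ munit C)) (op_functor (tens_left k))).
  { symmetry. exact (hom_to_adjoint _ (R_adj T k)). }
  transitivity (comp_functor
    (comp_functor (hom_to (munit C)) (op_functor (tens_left e)))
    (op_functor (tens_left k))).
  { assert (H := hom_to_adjoint (munit C) (R_adj T e)). now rewrite H. }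
  now rewrite comp_functor_op_comp, <- tens_left_tens, ek, tens_left_unit,
    comp_functor_op_id. }
assert (dr : d ⊗ r ≅ munit C).
{ now rewrite <- (left_right_inverse Rk_r rd). }
(* Both sides represent C(- ⊗ d, 1), because - ⊗ r is inverse to - ⊗ d. *)
assert (kr : k ≅ r).
{ rewrite <- (tens_unit_left k), <- (tens_unit_left r). apply yoneda.
  transitivity (comp_functor (hom_to (munit C)) (op_functor (tens_right d))).
  { symmetry. exact (hom_to_adjoint (munit C) (L_adj T d)). }
  transitivity (comp_functor
    (comp_functor (hom_to (munit C ⊗ r)) (op_functor (tens_right r)))
    (op_functor (tens_right d))).
  { assert (H := hom_to_equivalence (munit C) (tens_right_equivalence rd dr)).
    symmetry. now rewrite H. }
  now rewrite comp_functor_op_comp, <- tens_right_tens, dr, tens_right_unit,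
    comp_functor_op_id. }
rewrite kr in ek.
exists r. split; [exact ek|].
now rewrite (left_right_inverse ek rd).
Qed.

End QuasiInverse.
End Monoidal.

(** R and D ∘ (e ⊗ -) both dualise the unit, and the second is a composite of
equivalences. *)
Lemma right_dualising_equivalence (C : MonoidalCategory)
  (T : TensorRepresentable C) (d : C) :
  grothendieck_verdier d -> is_equivalence (right_dualising T).
Proof.
intros gv. apply grothendieck_verdier_dualises in gv.
destruct gv as [D [[K] [E DE]]].
destruct (predual_unit_invertible K DE T) as [r [er re]].
destruct (dualises_iso (dual_predual DE (munit C))
  (dualises_translate (E (munit C)) K)) as [K'].
apply (is_equivalence_iso (dualises_unique K'
  (rhom_functor_dualises (tensor_representable_closed T) (munit C)))).
apply is_equivalence_comp.
- exact (is_equivalence_op (tens_left_equivalence er re)).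
- now exists E.
Qed.

Theorem proposition3p16 (C : MonoidalCategory) (T : TensorRepresentable C) :
  ((exists Q : Functor C (op C), quasi_inverse (right_dualising T) Q) <->
   r_category C) /\
  (r_category C <-> (exists d : C, grothendieck_verdier d)).
Proof.
assert (r_of_equivalence : is_equivalence (right_dualising T) -> r_category C).
{ intros eR. apply grothendieck_verdier_dualises.
  exists (right_dualising T). split; [|exact eR].
  constructor. apply rhom_functor_dualises. }
split; split.
- exact r_of_equivalence.
- exact (@right_dualising_equivalence C T (munit C)).
- intros r. now exists (munit C).
- intros [d gv]. exact (r_of_equivalence (right_dualising_equivalence T gv)).
Qed.
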